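(* The category $\mathsf{ELHSLat}$ of equationally linear Heyting semilattices satisfies the condition (W).
   Context: A Heyting semilattice $(H,1,\wedge,\to)$ is a meet-semilattice with top element $1$ and a binary operation $\to$ such that $x\wedge y\leq z$ if and only if $x\leq y\to z$. Morphisms preserve $1$, $\wedge$ and $\to$. It is equationally linear when it satisfies $((x\to y)\to z)\wedge((y\to x)\to z)=z$. $\mathsf{ELHSLat}$ is the variety of equationally linear Heyting semilattices; it is a semi-abelian category (pointed, Barr exact, Bourn protomodular, with binary coproducts), whose zero object is $\{1\}$. In a semi-abelian category: two subobjects $x\colon X\rightarrowtail A$, $y\colon Y\rightarrowtail A$ Huq-commute when there is a morphism $\varphi\colon X\times Y\to A$ with $\varphi\circ(1_X,0)=x$ and $\varphi\circ(0,1_Y)=y$. The cosmash product $X\diamond Y$ is the kernel of the canonical morphism $X+Y\to X\times Y$, and the Higgins commutator $[X,Y]$ is the regular image of $X\diamond Y$ under $\langle x,y\rangle\colon X+Y\to A$; one has $[X,Y]=0$ if and only if $X$ and $Y$ Huq-commute. $\bar X$ denotes the normal closure of $X$ in $A$ (smallest normal subobject, i.e. kernel of some morphism, containing $X$). Condition (SH) (''Smith is Huq''): two equivalence relations $R$, $S$ on an object $A$ commute in the Smith sense if and only if their normalisations (the normal subobjects of $A$ given by the zero-classes of $R$ and $S$) Huq-commute. Here $R$ and $S$ commute in the Smith sense when there is a morphism $\theta\colon R\times_A S\to A$, defined on triples $(a,b,c)$ with $a\mathrel{R}b$ and $b\mathrel{S}c$, such that $\theta(a,a,c)=c$ and $\theta(a,c,c)=a$.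 Condition (W): the category satisfies (SH), and for all objects $A$ and all subobjects $X,Y$ of $A$, $[X,Y]=0$ if and only if $[\bar X,\bar Y]=0$. *)

(* Defs.v *)
From HB Require Import structures.
From mathcomp Require Import ssreflect ssrfun ssrbool eqtype ssrnat choice.
From mathcomp Require Import generic_quotient order.
From mathcomp Require Import boolp.

Set Implicit Arguments.
Unset Strict Implicit.
Unset Printing Implicit Defensive.

Declare Scope cat_scope.
Delimit Scope cat_scope with cat.
Local Open Scope cat_scope.

Reserved Notation "g ∘ f" (at level 40, left associativity).
Reserved Notation "x `->` y" (at level 53, right associativity).

Record category := Category {
  obj :> Type;
  Hom : obj -> obj -> Type;
  idm : forall A, Hom A A;
  comp : forall A B D, Hom B D -> Hom A B -> Hom A D;
  comp1m : forall A B (f : Hom A B), comp (idm B) f = f;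
  compm1 : forall A B (f : Hom A B), comp f (idm A) = f;
  compA : forall A B D E (h : Hom D E) (g : Hom B D) (f : Hom A B),
    comp h (comp g f) = comp (comp h g) f }.

Arguments Hom {c} A B.
Arguments idm {c} A.
Arguments comp {c A B D} g f.

Notation "g ∘ f" := (comp g f) : cat_scope.

Section UniversalProperties.
Variable C : category.
Implicit Types A B D X Y Z : C.

Definition mono A B (m : Hom A B) : Prop :=
  forall Z (u v : Hom Z A), m ∘ u = m ∘ v -> u = v.

Definition is_coequalizer Z A B (u v : Hom Z A) (e : Hom A B) : Prop :=
  e ∘ u = e ∘ v /\
  forall D (f : Hom A D), f ∘ u = f ∘ v -> exists! g : Hom B D, g ∘ e = f.

Definition regular_epi A B (e : Hom A B) : Prop :=
  exists Z (u v : Hom Z A), is_coequalizer u v e.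

Record zero_object := ZeroObject {
  zob :> C;
  zto : forall A, Hom A zob;
  zfrom : forall A, Hom zob A;
  zto_uniq : forall A (f g : Hom A zob), f = g;
  zfrom_uniq : forall A (f g : Hom zob A), f = g }.

Record product A B := Product {
  prod_ob :> C;
  fstm : Hom prod_ob A;
  sndm : Hom prod_ob B;
  pairm : forall Z, Hom Z A -> Hom Z B -> Hom Z prod_ob;
  fst_pairm : forall Z (f : Hom Z A) (g : Hom Z B), fstm ∘ pairm f g = f;
  snd_pairm : forall Z (f : Hom Z A) (g : Hom Z B), sndm ∘ pairm f g = g;
  pairm_uniq : forall Z (h k : Hom Z prod_ob),
    fstm ∘ h = fstm ∘ k -> sndm ∘ h = sndm ∘ k -> h = k }.

Record coproduct A B := Coproduct {
  coprod_ob :> C;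
  inlm : Hom A coprod_ob;
  inrm : Hom B coprod_ob;
  copairm : forall Z, Hom A Z -> Hom B Z -> Hom coprod_ob Z;
  copairm_inl : forall Z (f : Hom A Z) (g : Hom B Z), copairm f g ∘ inlm = f;
  copairm_inr : forall Z (f : Hom A Z) (g : Hom B Z), copairm f g ∘ inrm = g;
  copairm_uniq : forall Z (h k : Hom coprod_ob Z),
    h ∘ inlm = k ∘ inlm -> h ∘ inrm = k ∘ inrm -> h = k }.

Record pullback A B D (f : Hom A D) (g : Hom B D) := Pullback {
  pb_ob :> C;
  pb1 : Hom pb_ob A;
  pb2 : Hom pb_ob B;
  pb_comm : f ∘ pb1 = g ∘ pb2;
  pb_lift : forall Z (u : Hom Z A) (v : Hom Z B), f ∘ u = g ∘ v -> Hom Z pb_ob;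
  pb1_lift : forall Z (u : Hom Z A) (v : Hom Z B) (e : f ∘ u = g ∘ v),
    pb1 ∘ pb_lift e = u;
  pb2_lift : forall Z (u : Hom Z A) (v : Hom Z B) (e : f ∘ u = g ∘ v),
    pb2 ∘ pb_lift e = v;
  pb_uniq : forall Z (h k : Hom Z pb_ob),
    pb1 ∘ h = pb1 ∘ k -> pb2 ∘ h = pb2 ∘ k -> h = k }.

Record regular_image A B (f : Hom A B) := RegularImage {
  im_ob :> C;
  im_epi : Hom A im_ob;
  im_mono : Hom im_ob B;
  im_fact : im_mono ∘ im_epi = f;
  im_epiP : regular_epi im_epi;
  im_monoP : mono im_mono }.

Section WithZero.
Variable O : zero_object.

Definition zero_mor A B : Hom A B := zfrom O B ∘ zto O A.

Definition is_kernel K A B (k : Hom K A) (f : Hom A B) : Prop :=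
  f ∘ k = zero_mor K B /\
  forall Z (h : Hom Z A), f ∘ h = zero_mor Z B -> exists! u : Hom Z K, k ∘ u = h.

Definition normal_mono K A (k : Hom K A) : Prop :=
  exists B (f : Hom A B), is_kernel k f.

Definition subobject_le X Y A (x : Hom X A) (y : Hom Y A) : Prop :=
  exists u : Hom X Y, y ∘ u = x.

Record normal_closure X A (x : Hom X A) := NormalClosure {
  ncl_ob :> C;
  ncl_mono : Hom ncl_ob A;
  ncl_normal : normal_mono ncl_mono;
  ncl_contains : subobject_le x ncl_mono;
  ncl_smallest : forall N (n : Hom N A),
    normal_mono n -> subobject_le x n -> subobject_le ncl_mono n }.

End WithZero.
End UniversalProperties.

(* A pointed category with a choice of the limits, colimits, image            *)
(* factorisations and normal closures used below. All of them exist in a      *)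
(* semi-abelian category and are unique up to isomorphism.                    *)
Record pointed_category := PointedCategory {
  pcat :> category;
  zeroC : zero_object pcat;
  prodC : forall A B : pcat, product A B;
  coprodC : forall A B : pcat, coproduct A B;
  pullC : forall (A B D : pcat) (f : Hom A D) (g : Hom B D), pullback f g;
  imC : forall (A B : pcat) (f : Hom A B), regular_image f;
  nclC : forall (X A : pcat) (x : Hom X A), normal_closure zeroC x }.

Arguments zeroC {p}.
Arguments prodC {p} A B.
Arguments coprodC {p} A B.
Arguments pullC {p A B D} f g.
Arguments imC {p A B} f.
Arguments nclC {p X A} x.

Section Commutators.
Variable C : pointed_category.
Implicit Types A B X Y : C.

Definition zerom A B : Hom A B := zero_mor zeroC A B.

Definition kernel_pb A B (f : Hom A B) := pullC f (zfrom zeroC B).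
Definition kernel_ob A B (f : Hom A B) : C := kernel_pb f.
Definition kernel A B (f : Hom A B) : Hom (kernel_ob f) A := pb1 (kernel_pb f).

Definition huq_commute A X Y (x : Hom X A) (y : Hom Y A) : Prop :=
  exists phi : Hom (prodC X Y) A,
    phi ∘ pairm (prodC X Y) (idm X) (zerom X Y) = x /\
    phi ∘ pairm (prodC X Y) (zerom Y X) (idm Y) = y.

Definition coprod_to_prod X Y : Hom (coprodC X Y) (prodC X Y) :=
  copairm (coprodC X Y)
    (pairm (prodC X Y) (idm X) (zerom X Y))
    (pairm (prodC X Y) (zerom Y X) (idm Y)).

Definition cosmash X Y : C := kernel_ob (coprod_to_prod X Y).
Definition cosmash_incl X Y : Hom (cosmash X Y) (coprodC X Y) :=
  kernel (coprod_to_prod X Y).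

Definition higgins_image A X Y (x : Hom X A) (y : Hom Y A) :=
  imC (copairm (coprodC X Y) x y ∘ cosmash_incl X Y).
Definition higgins_ob A X Y (x : Hom X A) (y : Hom Y A) : C :=
  higgins_image x y.
Definition higgins A X Y (x : Hom X A) (y : Hom Y A) : Hom (higgins_ob x y) A :=
  im_mono (higgins_image x y).

Definition zero_subobject X A (x : Hom X A) : Prop :=
  subobject_le x (zfrom zeroC A).

Definition nclosure_ob X A (x : Hom X A) : C := nclC x.
Definition nclosure X A (x : Hom X A) : Hom (nclosure_ob x) A :=
  ncl_mono (nclC x).

Record equivalence_relation A := EquivalenceRelation {
  er_ob :> C;
  er1 : Hom er_ob A;
  er2 : Hom er_ob A;
  er_jointly_monic : forall Z (u v : Hom Z er_ob),
    er1 ∘ u = er1 ∘ v -> er2 ∘ u = er2 ∘ v -> u = v;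
  er_refl : Hom A er_ob;
  er1_refl : er1 ∘ er_refl = idm A;
  er2_refl : er2 ∘ er_refl = idm A;
  er_sym : exists s : Hom er_ob er_ob, er1 ∘ s = er2 /\ er2 ∘ s = er1;
  er_trans : exists t : Hom (pullC er2 er1) er_ob,
    er1 ∘ t = er1 ∘ pb1 (pullC er2 er1) /\
    er2 ∘ t = er2 ∘ pb2 (pullC er2 er1) }.

(* The zero-class {b | 0 R b}.                                                *)
Definition normalisation_ob A (R : equivalence_relation A) : C :=
  kernel_ob (er1 R).
Definition normalisation A (R : equivalence_relation A) :
    Hom (normalisation_ob R) A :=
  er2 R ∘ kernel (er1 R).

Section Smith.
Variables (A : C) (R S : equivalence_relation A).

(* The object of triples (a, b, c) with a R b and b S c.                      *)
Definition smith_pb := pullC (er2 R) (er1 S).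

Lemma smith_inr_eq : er2 R ∘ (er_refl R ∘ er1 S) = er1 S ∘ idm S.
Proof. by rewrite compA er2_refl comp1m compm1. Qed.

Lemma smith_inl_eq : er2 R ∘ idm R = er1 S ∘ (er_refl S ∘ er2 R).
Proof. by rewrite compA er1_refl comp1m compm1. Qed.

(* (a, c) |-> (a, a, c), for a S c.                                           *)
Definition smith_inr : Hom S smith_pb := pb_lift smith_pb smith_inr_eq.
(* (a, c) |-> (a, c, c), for a R c.                                           *)
Definition smith_inl : Hom R smith_pb := pb_lift smith_pb smith_inl_eq.

Definition smith_commute : Prop :=
  exists theta : Hom smith_pb A,
    theta ∘ smith_inr = er2 S /\ theta ∘ smith_inl = er1 R.
End Smith.

Definition condition_SH : Prop :=
  forall (A : C) (R S : equivalence_relation A),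
    smith_commute R S <-> huq_commute (normalisation R) (normalisation S).

Definition condition_W : Prop :=
  condition_SH /\
  forall (A X Y : C) (x : Hom X A) (y : Hom Y A), mono x -> mono y ->
    (zero_subobject (higgins x y) <->
     zero_subobject (higgins (nclosure x) (nclosure y))).

End Commutators.

Import Order.Theory.
Local Open Scope order_scope.

HB.mixin Record hasHeytingImp d T of Order.TMeetSemilattice d T := {
  himp : T -> T -> T;
  leIx_himp : forall x y z : T, (x `&` y <= z) = (x <= himp y z) }.

#[short(type="heytingSemilatticeType")]
HB.structure Definition HeytingSemilattice d :=
  { T of hasHeytingImp d T & Order.TMeetSemilattice d T }.

Notation "x `->` y" := (himp x y) : order_scope.

HB.mixin Record isEquationallyLinear d T of HeytingSemilattice d T := {
  himp_linear : forall x y z : T,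
    ((x `->` y) `->` z) `&` ((y `->` x) `->` z) = z }.

#[short(type="elhslatType")]
HB.structure Definition ELHSLattice d :=
  { T of isEquationallyLinear d T & HeytingSemilattice d T }.

(* Construction from the algebraic operations; x <= y is x /\ y = x.          *)
HB.factory Record isELHSLattice (d : Order.disp_t) T of Choice T := {
  hone : T;
  hand : T -> T -> T;
  harr : T -> T -> T;
  handA : associative hand;
  handC : commutative hand;
  handxx : idempotent_op hand;
  handx1 : forall x, hand x hone = x;
  hand_harr : forall x y z,
    hand (hand x y) z = hand x y <-> hand x (harr y z) = x;
  harr_linear : forall x y z,
    hand (harr (harr x y) z) (harr (harr y x) z) = z }.

HB.builders Context d T of isELHSLattice d T.

Let le (x y : T) := hand x y == x.

Let le_refl : reflexive le. Proof. by move=> x; rewrite /le handxx. Qed.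

Let le_anti : antisymmetric le.
Proof. by move=> x y /andP[/eqP xy /eqP yx]; rewrite -xy handC yx. Qed.

Let le_trans : transitive le.
Proof.
by move=> y x z /eqP xy /eqP yz; rewrite /le -xy -handA yz.
Qed.

HB.instance Definition _ :=
  @Order.Le_isPOrder.Build d T le le_refl le_anti le_trans.

Let lexI (x y z : T) : (x <= hand y z) = (x <= y) && (x <= z).
Proof.
rewrite /Order.le /= /le; apply/eqP/andP => [<-|[/eqP xy /eqP xz]].
  split; apply/eqP; last by rewrite -!handA handxx.
  by rewrite [hand y z]handC -!handA handxx.
by rewrite handA xy xz.
Qed.

HB.instance Definition _ := @Order.POrder_isMeetSemilattice.Build d T hand lexI.

Let lex1 (x : T) : x <= hone.
Proof. by rewrite /Order.le /= /le handx1. Qed.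

HB.instance Definition _ := @Order.hasTop.Build d T hone lex1.

Let le_harr (x y z : T) : (x `&` y <= z) = (x <= harr y z).
Proof. by apply/eqP/eqP => /hand_harr. Qed.

HB.instance Definition _ := @hasHeytingImp.Build d T harr le_harr.
HB.instance Definition _ := @isEquationallyLinear.Build d T harr_linear.
HB.end.

Record hsl_hom d (A B : heytingSemilatticeType d) := HslHom {
  hsl_fun :> A -> B;
  hsl_top : hsl_fun \top = \top;
  hsl_meet : {morph hsl_fun : x y / x `&` y};
  hsl_himp : {morph hsl_fun : x y / x `->` y} }.

Lemma hsl_homP d (A B : heytingSemilatticeType d) (f g : hsl_hom A B) :
  f =1 g -> f = g.
Proof.
case: f g => f f1 f2 f3 [g g1 g2 g3] /= /funext fg; case: _ / fg g1 g2 g3 => *.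
by congr HslHom; exact: Prop_irrelevance.
Qed.

Lemma hsl_homE d (A B : heytingSemilatticeType d) (f g : hsl_hom A B) :
  f = g -> f =1 g.
Proof. by move=> ->. Qed.

Section HslHoms.
Variable d : Order.disp_t.
Implicit Types A B D : heytingSemilatticeType d.

Definition hsl_id A : hsl_hom A A.
Proof. by exists id. Defined.

Definition hsl_comp A B D (g : hsl_hom B D) (f : hsl_hom A B) : hsl_hom A D.
Proof.
exists (g \o f) => [|x y|x y] /=; first by rewrite !hsl_top.
- by rewrite !hsl_meet.
- by rewrite !hsl_himp.
Defined.
End HslHoms.

Definition elhslat_cat (d : Order.disp_t) : category.
Proof.
exists (elhslatType d) (fun A B => hsl_hom A B) (fun A => hsl_id A)
  (fun A B D g f => hsl_comp g f).
- by move=> *; exact: hsl_homP.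
- by move=> *; exact: hsl_homP.
- by move=> *; exact: hsl_homP.
Defined.

Section Theory.
Variable d : Order.disp_t.
Implicit Types A B : elhslatType d.

Lemma le_meetP A (x y : A) : (x <= y) <-> (x `&` y = x).
Proof. by rewrite leEmeet; split => /eqP. Qed.

Lemma and_himp A (x y z : A) :
  x `&` y `&` z = x `&` y <-> x `&` (y `->` z) = x.
Proof. by rewrite -!le_meetP leIx_himp. Qed.

End Theory.

Definition unit_elhs (d : Order.disp_t) := unit.
HB.instance Definition _ d := Choice.on (unit_elhs d).
Section UnitAlgebra.
Variable d : Order.disp_t.
Let op (x y : unit_elhs d) : unit_elhs d := tt.
Let opA : associative op. Proof. by []. Qed.
Let opC : commutative op. Proof. by []. Qed.
Let opxx : idempotent_op op. Proof. by case. Qed.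
Let opx1 (x : unit_elhs d) : op x tt = x. Proof. by case: x. Qed.
Let op_arr (x y z : unit_elhs d) : op (op x y) z = op x y <-> op x (op y z) = x.
Proof. by case: x. Qed.
Let op_lin (x y z : unit_elhs d) : op (op (op x y) z) (op (op y x) z) = z.
Proof. by case: z. Qed.
HB.instance Definition _ :=
  @isELHSLattice.Build d (unit_elhs d) tt op op opA opC opxx opx1 op_arr op_lin.
End UnitAlgebra.

Definition unit_alg d : elhslatType d := ELHSLattice.clone d (unit_elhs d) _.

Definition elhs_zero d : zero_object (elhslat_cat d).
Proof.
unshelve refine (@ZeroObject (elhslat_cat d) (unit_alg d) _ _ _ _).
- by move=> A; exists (fun=> tt).
- move=> A; exists (fun=> \top) => // x y; first by rewrite meetxx.
  by apply/eqP; rewrite eq_le lex1 andbT -leIx_himp lex1.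
- by move=> A f g; apply: hsl_homP => x; case: (f x); case: (g x).
- by move=> A f g; apply: hsl_homP => -[]; rewrite (hsl_top f) (hsl_top g).
Defined.

Definition prod_elhs d (A B : elhslatType d) := (A * B)%type.
HB.instance Definition _ d A B := Choice.on (@prod_elhs d A B).
Section ProdAlgebra.
Variables (d : Order.disp_t) (A B : elhslatType d).
Let T := prod_elhs A B.
Let one : T := (\top, \top).
Let and (x y : T) : T := (x.1 `&` y.1, x.2 `&` y.2).
Let arr (x y : T) : T := (x.1 `->` y.1, x.2 `->` y.2).
Let andA : associative and. Proof. by move=> *; rewrite /and /= !meetA. Qed.
Let andC : commutative and.
Proof. by move=> x y; rewrite /and meetC [y.2 `&` _]meetC. Qed.
Let andxx : idempotent_op and. Proof. by case=> *; rewrite /and /= !meetxx. Qed.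
Let andx1 (x : T) : and x one = x. Proof. by case: x => *; rewrite /and /= !meetx1. Qed.
Let and_arr (x y z : T) : and (and x y) z = and x y <-> and x (arr y z) = x.
Proof.
by case: x y z => [x x'] [y y'] [z z']; split=> -[] /and_himp e /and_himp e';
  congr pair.
Qed.
Let arr_lin (x y z : T) : and (arr (arr x y) z) (arr (arr y x) z) = z.
Proof. by case: z => *; rewrite /and /= !himp_linear. Qed.
HB.instance Definition _ :=
  @isELHSLattice.Build d (prod_elhs A B) one and arr andA andC andxx andx1 and_arr arr_lin.
End ProdAlgebra.

Definition prod_alg d (A B : elhslatType d) : elhslatType d :=
  ELHSLattice.clone d (prod_elhs A B) _.

Definition elhs_prod d (A B : elhslat_cat d) : product A B.
Proof.
unshelve refine (@Product (elhslat_cat d) A B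
  (prod_alg A B) _ _ _ _ _ _).
- by exists fst.
- by exists snd.
- move=> Z f g; exists (fun z => (f z, g z)).
  + by rewrite !hsl_top.
  + by move=> x y; rewrite !hsl_meet.
  + by move=> x y; rewrite !hsl_himp.
- by move=> *; exact: hsl_homP.
- by move=> *; exact: hsl_homP.
- move=> Z h k e1 e2; apply: hsl_homP => z.
  have := hsl_homE e1 z.
  have := hsl_homE e2 z.
  by rewrite /=; case: (h z) => ? ?; case: (k z) => ? ? /= -> ->.
Defined.

Record subalg d (A : elhslatType d) := Subalg {
  sa_pred :> pred A;
  sa_top : sa_pred \top;
  sa_meet : forall x y, sa_pred x -> sa_pred y -> sa_pred (x `&` y);
  sa_himp : forall x y, sa_pred x -> sa_pred y -> sa_pred (x `->` y) }.

Definition sub_elhs d (A : elhslatType d) (P : subalg A) := {x : A | P x}.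
HB.instance Definition _ d A P := Choice.on (@sub_elhs d A P).
Section SubAlgebra.
Variables (d : Order.disp_t) (A : elhslatType d) (P : subalg A).
Let T := sub_elhs P.
Let one : T := exist _ \top (sa_top P).
Let and (x y : T) : T := exist _ (sval x `&` sval y) (sa_meet (svalP x) (svalP y)).
Let arr (x y : T) : T := exist _ (sval x `->` sval y) (sa_himp (svalP x) (svalP y)).
Let andA : associative and. Proof. by move=> *; apply: val_inj; exact: meetA. Qed.
Let andC : commutative and. Proof. by move=> *; apply: val_inj; exact: meetC. Qed.
Let andxx : idempotent_op and. Proof. by move=> *; apply: val_inj; exact: meetxx. Qed.
Let andx1 (x : T) : and x one = x. Proof. by apply: val_inj; exact: meetx1. Qed.
Let and_arr (x y z : T) : and (and x y) z = and x y <-> and x (arr y z) = x.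
Proof.
by split=> /(congr1 val) /and_himp e; apply: val_inj.
Qed.
Let arr_lin (x y z : T) : and (arr (arr x y) z) (arr (arr y x) z) = z.
Proof. by apply: val_inj; exact: himp_linear. Qed.
HB.instance Definition _ :=
  @isELHSLattice.Build d (sub_elhs P) one and arr andA andC andxx andx1 and_arr arr_lin.

Definition sub_alg : elhslatType d := ELHSLattice.clone d (sub_elhs P) _.

Definition sub_incl : hsl_hom sub_alg A.
Proof. by exists sval. Defined.

Definition sub_lift (Z : elhslatType d) (f : hsl_hom Z A) (fP : forall z, P (f z)) :
  hsl_hom Z sub_alg.
Proof.
exists (fun z => exist _ (f z) (fP z)).
- by apply: val_inj; rewrite /= hsl_top.
- by move=> x y; apply: val_inj; rewrite /= hsl_meet.
- by move=> x y; apply: val_inj; rewrite /= hsl_himp.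
Defined.
End SubAlgebra.

Lemma sub_incl_mono d (A : elhslatType d) (P : subalg A) :
  @mono (elhslat_cat d) (sub_alg P) A (sub_incl P).
Proof.
move=> Z u v e; apply: hsl_homP => z; apply: val_inj.
exact: (hsl_homE e z).
Qed.

Definition pull_subalg d (A B D : elhslatType d) (f : hsl_hom A D) (g : hsl_hom B D) :
  subalg (prod_alg A B).
Proof.
exists (fun ab => f ab.1 == g ab.2).
- by rewrite /= !hsl_top.
- by move=> x y /eqP xE /eqP yE; rewrite /= !hsl_meet xE yE.
- by move=> x y /eqP xE /eqP yE; rewrite /= !hsl_himp xE yE.
Defined.

Definition elhs_pull d (A B D : elhslat_cat d) (f : Hom A D) (g : Hom B D) :
  pullback f g.
Proof.
unshelve refine (@Pullback (elhslat_cat d) A B D f g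
  (sub_alg (pull_subalg f g))
  (fstm (elhs_prod A B) ∘ (sub_incl (pull_subalg f g) : @Hom (elhslat_cat d) _ _))
  (sndm (elhs_prod A B) ∘ (sub_incl (pull_subalg f g) : @Hom (elhslat_cat d) _ _))
  _ _ _ _ _).
- move=> Z u v e; apply: (@sub_lift _ _ _ Z (pairm (elhs_prod A B) u v)) => z.
  by apply/eqP; exact: (hsl_homE e z).
- by apply: (@hsl_homP _ _ D) => -[x /= /eqP].
- by move=> *; exact: hsl_homP.
- by move=> *; exact: hsl_homP.
- move=> Z h k e1 e2; apply: (@sub_incl_mono d _ (pull_subalg f g)).
  by apply: (pairm_uniq (p := elhs_prod A B)); rewrite !compA.
Defined.

Definition im_subalg d (A B : elhslatType d) (f : hsl_hom A B) : subalg B.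
Proof.
exists (fun b => `[< exists a, f a = b >]).
- by apply/asboolP; exists \top; rewrite hsl_top.
- by move=> _ _ /asboolP[x <-] /asboolP[y <-]; apply/asboolP; exists (x `&` y);
    rewrite hsl_meet.
- by move=> _ _ /asboolP[x <-] /asboolP[y <-]; apply/asboolP; exists (x `->` y);
    rewrite hsl_himp.
Defined.

Lemma surj_regular_epi d (A B : elhslat_cat d) (e : Hom A B) :
  (forall b, exists a, (e : hsl_hom _ _) a = b) -> regular_epi e.
Proof.
move=> e_surj; exists (pb_ob (elhs_pull e e)), (pb1 (elhs_pull e e)), (pb2 (elhs_pull e e)).
split=> [|D f fE]; first exact: pb_comm.
have fP a a' : (e : hsl_hom _ _) a = (e : hsl_hom _ _) a' ->
    (f : hsl_hom _ _) a = (f : hsl_hom _ _) a'.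
  move=> /eqP ee.
  exact: (hsl_homE fE (exist _ (a, a') ee : sub_alg (pull_subalg e e))).
have [s sK] := choice e_surj.
unshelve eexists.
  exists (fun b => (f : hsl_hom _ _) (s b)).
  - by rewrite -(hsl_top f); apply: fP; rewrite sK hsl_top.
  - by move=> x y; rewrite -(hsl_meet f); apply: fP; rewrite sK hsl_meet !sK.
  - by move=> x y; rewrite -(hsl_himp f); apply: fP; rewrite sK hsl_himp !sK.
split=> [|g gE]; first by apply: hsl_homP => a /=; apply: fP; rewrite sK.
by apply: (@hsl_homP _ B D) => b /=; rewrite -gE /= sK.
Qed.

Definition elhs_image d (A B : elhslat_cat d) (f : Hom A B) : regular_image f.
Proof.
have fP a : im_subalg f ((f : hsl_hom _ _) a) by apply/asboolP; exists a.
apply: (@RegularImage (elhslat_cat d) A B f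
  (sub_alg (im_subalg f)) (sub_lift fP) (sub_incl (im_subalg f))).
- exact: hsl_homP.
- apply: surj_regular_epi => -[b bP]; have /asboolP[a ab] := bP.
  by exists a; apply: val_inj.
- exact: sub_incl_mono.
Defined.

(* A raw algebra that satisfies the axioms up to a congruence.                *)
Record raw_elhs := RawElhs {
  raw :> choiceType;
  r1 : raw;
  ra : raw -> raw -> raw;
  ri : raw -> raw -> raw;
  req : raw -> raw -> Prop;
  req_refl : forall x, req x x;
  req_sym : forall x y, req x y -> req y x;
  req_trans : forall x y z, req x y -> req y z -> req x z;
  req_ra : forall x x' y y', req x x' -> req y y' -> req (ra x y) (ra x' y');
  req_ri : forall x x' y y', req x x' -> req y y' -> req (ri x y) (ri x' y');
  req_raA : forall x y z, req (ra x (ra y z)) (ra (ra x y) z);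
  req_raC : forall x y, req (ra x y) (ra y x);
  req_raxx : forall x, req (ra x x) x;
  req_rax1 : forall x, req (ra x r1) x;
  req_adj : forall x y z, req (ra (ra x y) z) (ra x y) <-> req (ra x (ri y z)) x;
  req_lin : forall x y z, req (ra (ri (ri x y) z) (ri (ri y x) z)) z }.

Section QuotType.
Variable (R : raw_elhs).
Definition req_rel : rel R := fun x y => `[< @req R x y >].
Lemma req_rel_refl : reflexive req_rel.
Proof. by move=> x; apply/asboolP; exact: req_refl. Qed.
Lemma req_rel_sym : symmetric req_rel.
Proof. by move=> x y; apply/asboolP/asboolP; exact: req_sym. Qed.
Lemma req_rel_trans : transitive req_rel.
Proof.
by move=> y x z /asboolP xy /asboolP yz; apply/asboolP; exact: req_trans yz.
Qed.
Canonical req_equiv := EquivRel req_rel req_rel_refl req_rel_sym req_rel_trans.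
End QuotType.

Local Open Scope quotient_scope.
Definition quot_elhs (d : Order.disp_t) (R : raw_elhs) := {eq_quot (req_equiv R)}.
HB.instance Definition _ d R := Choice.on (quot_elhs d R).

Section QuotAlgebra.
Variables (d : Order.disp_t) (R : raw_elhs).
Local Open Scope quotient_scope.
Let T := quot_elhs d R.
Definition cls (x : R) : T := \pi_({eq_quot (req_equiv R)}) x.

Lemma clsP x y : cls x = cls y <-> req x y.
Proof. by split=> [/eqmodP/asboolP|xy]; last by apply/eqmodP/asboolP. Qed.

Lemma cls_surj (q : T) : exists x, cls x = q.
Proof. by exists (repr q); exact: reprK. Qed.

Let and (p q : T) : T := cls (ra (repr p) (repr q)).
Let arr (p q : T) : T := cls (ri (repr p) (repr q)).

Let repr_cls x : req (repr (cls x)) x.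
Proof. by apply/clsP; exact: reprK. Qed.

Let andE x y : and (cls x) (cls y) = cls (ra x y).
Proof. by apply/clsP; apply: req_ra; exact: repr_cls. Qed.
Let arrE x y : arr (cls x) (cls y) = cls (ri x y).
Proof. by apply/clsP; apply: req_ri; exact: repr_cls. Qed.

Let andA : associative and.
Proof.
move=> p q r; have [[[x <-] [y <-]] [z <-]] := (cls_surj p, cls_surj q, cls_surj r).
by rewrite !andE; apply/clsP; exact: req_raA.
Qed.
Let andC : commutative and.
Proof.
move=> p q; have [[x <-] [y <-]] := (cls_surj p, cls_surj q).
by rewrite !andE; apply/clsP; exact: req_raC.
Qed.
Let andxx : idempotent_op and.
Proof.
by move=> p; have [x <-] := cls_surj p; rewrite !andE; apply/clsP; exact: req_raxx.
Qed.
Let andx1 (p : T) : and p (cls (r1 R)) = p.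
Proof. by have [x <-] := cls_surj p; rewrite !andE; apply/clsP; exact: req_rax1. Qed.
Let and_arr (p q r : T) : and (and p q) r = and p q <-> and p (arr q r) = p.
Proof.
have [[[x <-] [y <-]] [z <-]] := (cls_surj p, cls_surj q, cls_surj r).
by rewrite arrE !andE !clsP; exact: req_adj.
Qed.
Let arr_lin (p q r : T) : and (arr (arr p q) r) (arr (arr q p) r) = r.
Proof.
have [[[x <-] [y <-]] [z <-]] := (cls_surj p, cls_surj q, cls_surj r).
by rewrite !arrE andE; apply/clsP; exact: req_lin.
Qed.
HB.instance Definition _ := @isELHSLattice.Build d (quot_elhs d R)
  (cls (r1 R)) and arr andA andC andxx andx1 and_arr arr_lin.

Lemma cls_top : cls (r1 R) = \top. Proof. by []. Qed.
Lemma cls_meet x y : cls (ra x y) = cls x `&` cls y. Proof. by rewrite -andE. Qed.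
Lemma cls_himp x y : cls (ri x y) = cls x `->` cls y. Proof. by rewrite -arrE. Qed.

Definition quot_alg : elhslatType d := ELHSLattice.clone d (quot_elhs d R) _.

Section Lift.
Variables (B : elhslatType d) (f : R -> B).
Hypotheses (f1 : f (r1 R) = \top) (fa : forall x y, f (ra x y) = f x `&` f y).
Hypotheses (fi : forall x y, f (ri x y) = f x `->` f y).
Hypothesis (fP : forall x y, req x y -> f x = f y).

Definition quot_lift : hsl_hom quot_alg B.
Proof.
exists (fun q : quot_elhs d R => f (repr (q : {eq_quot (req_equiv R)}))).
- by rewrite -f1; apply: fP; exact: repr_cls.
- move=> p q; rewrite -fa; apply: fP; exact: repr_cls.
- move=> p q; rewrite -fi; apply: fP; exact: repr_cls.
Defined.

Lemma quot_liftE x : quot_lift (cls x) = f x.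
Proof. by apply: fP; exact: repr_cls. Qed.
End Lift.
End QuotAlgebra.

(* The coproduct is presented by generators and relations.                    *)
Section CoproductAlgebra.
Variables (d : Order.disp_t) (A B : elhslatType d).

Inductive cterm :=
  | Cinl of A | Cinr of B | Cone | Cand of cterm & cterm | Carr of cterm & cterm.

HB.instance Definition _ := gen_eqMixin cterm.
HB.instance Definition _ := gen_choiceMixin cterm.

Inductive ceq : cterm -> cterm -> Prop :=
  | ceq_refl x : ceq x x
  | ceq_sym x y : ceq x y -> ceq y x
  | ceq_trans x y z : ceq x y -> ceq y z -> ceq x z
  | ceq_and x x' y y' : ceq x x' -> ceq y y' -> ceq (Cand x y) (Cand x' y')
  | ceq_arr x x' y y' : ceq x x' -> ceq y y' -> ceq (Carr x y) (Carr x' y')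
  | ceq_andA x y z : ceq (Cand x (Cand y z)) (Cand (Cand x y) z)
  | ceq_andC x y : ceq (Cand x y) (Cand y x)
  | ceq_andxx x : ceq (Cand x x) x
  | ceq_andx1 x : ceq (Cand x Cone) x
  | ceq_adj1 x y z :
      ceq (Cand (Cand x y) z) (Cand x y) -> ceq (Cand x (Carr y z)) x
  | ceq_adj2 x y z :
      ceq (Cand x (Carr y z)) x -> ceq (Cand (Cand x y) z) (Cand x y)
  | ceq_lin x y z : ceq (Cand (Carr (Carr x y) z) (Carr (Carr y x) z)) z
  | ceq_inl1 : ceq (Cinl \top) Cone
  | ceq_inr1 : ceq (Cinr \top) Cone
  | ceq_inla a a' : ceq (Cinl (a `&` a')) (Cand (Cinl a) (Cinl a'))
  | ceq_inra b b' : ceq (Cinr (b `&` b')) (Cand (Cinr b) (Cinr b'))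
  | ceq_inli a a' : ceq (Cinl (a `->` a')) (Carr (Cinl a) (Cinl a'))
  | ceq_inri b b' : ceq (Cinr (b `->` b')) (Carr (Cinr b) (Cinr b')).

Definition coprod_raw : raw_elhs :=
  @RawElhs cterm Cone Cand Carr ceq ceq_refl ceq_sym ceq_trans ceq_and ceq_arr
    ceq_andA ceq_andC ceq_andxx ceq_andx1
    (fun x y z => conj (@ceq_adj1 x y z) (@ceq_adj2 x y z)) ceq_lin.

Definition coprod_elhs : elhslatType d := quot_alg d coprod_raw.

Definition coprod_inl : hsl_hom A coprod_elhs.
Proof.
exists (fun a => cls d (Cinl a : coprod_raw)).
- by rewrite -cls_top; apply/clsP; exact: ceq_inl1.
- by move=> x y; rewrite -cls_meet; apply/clsP; exact: ceq_inla.
- by move=> x y; rewrite -cls_himp; apply/clsP; exact: ceq_inli.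
Defined.

Definition coprod_inr : hsl_hom B coprod_elhs.
Proof.
exists (fun a => cls d (Cinr a : coprod_raw)).
- by rewrite -cls_top; apply/clsP; exact: ceq_inr1.
- by move=> x y; rewrite -cls_meet; apply/clsP; exact: ceq_inra.
- by move=> x y; rewrite -cls_himp; apply/clsP; exact: ceq_inri.
Defined.

Section Eval.
Variables (Z : elhslatType d) (f : hsl_hom A Z) (g : hsl_hom B Z).

Fixpoint ceval (t : cterm) : Z :=
  match t with
  | Cinl a => f a
  | Cinr b => g b
  | Cone => \top
  | Cand x y => ceval x `&` ceval y
  | Carr x y => ceval x `->` ceval y
  end.

Lemma cevalP x y : ceq x y -> ceval x = ceval y.
Proof.
elim=> {x y} //=; try by move=> *; congruence.
- by move=> *; rewrite meetA.
- by move=> *; rewrite meetC.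
- by move=> *; rewrite meetxx.
- by move=> *; rewrite meetx1.
- by move=> x y z _ /and_himp.
- by move=> x y z _ /and_himp.
- by move=> *; rewrite himp_linear.
- by rewrite hsl_top.
- by rewrite hsl_top.
- by move=> *; rewrite hsl_meet.
- by move=> *; rewrite hsl_meet.
- by move=> *; rewrite hsl_himp.
- by move=> *; rewrite hsl_himp.
Qed.

Definition coprod_case : hsl_hom coprod_elhs Z :=
  @quot_lift d coprod_raw Z ceval erefl (fun _ _ => erefl) (fun _ _ => erefl) cevalP.

Lemma coprod_caseE t : coprod_case (cls d (t : coprod_raw)) = ceval t.
Proof. exact: quot_liftE. Qed.
End Eval.
End CoproductAlgebra.

Definition elhs_coprod d (A B : elhslat_cat d) : coproduct A B.
Proof.
apply: (@Coproduct (elhslat_cat d) A B (coprod_elhs (A : elhslatType d) B)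
  (coprod_inl A B) (coprod_inr A B) (fun Z f g => coprod_case f g)).
- by move=> Z f g; apply: hsl_homP => a; exact: coprod_caseE.
- by move=> Z f g; apply: hsl_homP => b; exact: coprod_caseE.
- move=> Z h k el er; apply: hsl_homP => q; have [t <-] := cls_surj q.
  elim: t => [a|b||x IHx y IHy|x IHx y IHy].
  + exact: (hsl_homE el a).
  + exact: (hsl_homE er b).
  + by rewrite -[Cone _ _]/(r1 (coprod_raw _ _)) cls_top !hsl_top.
  + by rewrite -[Cand x y]/(ra (x : coprod_raw _ _) y) cls_meet !hsl_meet IHx IHy.
  + by rewrite -[Carr x y]/(ri (x : coprod_raw _ _) y) cls_himp !hsl_himp IHx IHy.
Defined.

(* The normal closure of x : X -> A is the filter generated by its image,     *)
(* i.e. the class of 1 for the congruence a ~ b iff x t /\ a = x t /\ b for   *)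
(* some t in X.                                                               *)
Section NormalClosureAlgebra.
Variables (d : Order.disp_t) (X A : elhslatType d) (x : hsl_hom X A).

Definition filter_eq (a b : A) : Prop := exists t, x t `&` a = x t `&` b.

Let geq_refl a : filter_eq a a. Proof. by exists \top. Qed.
Let geq_sym a b : filter_eq a b -> filter_eq b a.
Proof. by case=> t e; exists t. Qed.
Let geq_trans a b c : filter_eq a b -> filter_eq b c -> filter_eq a c.
Proof.
case=> t e [s e']; exists (t `&` s); rewrite hsl_meet.
by rewrite meetAC e meetAC -!meetA e'.
Qed.
Let geq_and a a' b b' :
  filter_eq a a' -> filter_eq b b' -> filter_eq (a `&` b) (a' `&` b').
Proof.
case=> t e [s e']; exists (t `&` s).
by rewrite hsl_meet meetACA e e' meetACA.
Qed.

Let himp_mp (a b : A) : a `&` (a `->` b) <= b.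
Proof. by rewrite meetC leIx_himp. Qed.

Let le_himp (u a a' b b' : A) : u `&` a = u `&` a' -> u `&` b = u `&` b' ->
  u `&` (a `->` b) <= u `&` (a' `->` b').
Proof.
move=> ea eb; rewrite lexI leIl -leIx_himp meetAC -ea -meetA.
have le_b : u `&` (a `&` (a `->` b)) <= u `&` b by rewrite leI2.
by apply: le_trans le_b _; rewrite eb leIr.
Qed.

Let geq_himp a a' b b' :
  filter_eq a a' -> filter_eq b b' -> filter_eq (a `->` b) (a' `->` b').
Proof.
case=> t e [s e']; exists (t `&` s); set u := x _.
have ea : u `&` a = u `&` a'.
  by rewrite /u hsl_meet [x t `&` _]meetC -!meetA e.
have eb : u `&` b = u `&` b' by rewrite /u hsl_meet -!meetA e'.
by apply/eqP; rewrite eq_le !le_himp.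
Qed.

Let eq_geq a b : a = b -> filter_eq a b.
Proof. by move=> ->; exact: geq_refl. Qed.

Let geq_adj a b c :
  filter_eq (a `&` b `&` c) (a `&` b) <-> filter_eq (a `&` (b `->` c)) a.
Proof.
split=> -[t]; rewrite !meetA => e; exists t; rewrite !meetA.
  exact: (proj1 (and_himp _ _ _) e).
exact: (proj2 (and_himp _ _ _) e).
Qed.

Definition ncl_raw : raw_elhs :=
  @RawElhs A \top (fun a b => a `&` b) (fun a b => a `->` b) filter_eq
    geq_refl geq_sym geq_trans geq_and geq_himp
    (fun a b c => eq_geq (meetA a b c)) (fun a b => eq_geq (meetC a b))
    (fun a => eq_geq (meetxx a)) (fun a => eq_geq (meetx1 a))
    geq_adj (fun a b c => eq_geq (himp_linear a b c)).

Definition ncl_quot : hsl_hom A (quot_alg d ncl_raw).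
Proof.
exists (fun a => cls d (a : ncl_raw)) => // a b.
- exact: (@cls_meet d ncl_raw a b).
- exact: (@cls_himp d ncl_raw a b).
Defined.

Lemma ncl_quotE a : ncl_quot a = \top <-> exists t, x t <= a.
Proof.
rewrite -[\top]/(ncl_quot \top); split=> [/clsP[t /= e]|[t /le_meetP e]].
  by exists t; apply/le_meetP; rewrite e meetx1.
by apply/clsP; exists t; rewrite /= e meetx1.
Qed.

Definition ncl_subalg : subalg A.
Proof.
exists (fun a => `[< exists t, x t <= a >]).
- by apply/asboolP/ncl_quotE; exact: hsl_top.
- move=> a b /asboolP/ncl_quotE aE /asboolP/ncl_quotE bE.
  by apply/asboolP/ncl_quotE; rewrite hsl_meet aE bE meetxx.
- move=> a b /asboolP[t _] /asboolP[s xs]; apply/asboolP; exists s.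
  by rewrite -leIx_himp (le_trans (leIl _ _)).
Defined.
End NormalClosureAlgebra.

Definition elhs_ncl d (X A : elhslat_cat d) (x : Hom X A) :
  normal_closure (elhs_zero d) x.
Proof.
have xP t : ncl_subalg x ((x : hsl_hom _ _) t) by apply/asboolP; exists t.
apply: (@NormalClosure (elhslat_cat d) (elhs_zero d) X A x
  (sub_alg (ncl_subalg x)) (sub_incl (ncl_subalg x))).
- exists (quot_alg d (ncl_raw x)), (ncl_quot x); split.
    by apply: hsl_homP => -[a aP]; exact/ncl_quotE/asboolP.
  move=> Z h hE.
  have hP z : ncl_subalg x ((h : hsl_hom _ _) z).
    by apply/asboolP/ncl_quotE; exact: (hsl_homE hE z).
  exists (sub_lift hP); split=> [|u uE]; first exact: hsl_homP.
  by apply: (@sub_incl_mono _ _ (ncl_subalg x)); rewrite uE; exact: hsl_homP.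
- by exists (sub_lift xP); exact: hsl_homP.
- move=> N n [B [f [fn f_univ]]] [u uE].
  have f0 : f ∘ (sub_incl (ncl_subalg x) : @Hom (elhslat_cat d) (sub_alg _) A) =
      zero_mor (elhs_zero d) _ B.
    apply: (@hsl_homP _ _ B) => -[a aP]; have /asboolP[t xa] := aP.
    have ft : (f : hsl_hom _ _) ((x : hsl_hom _ _) t) = \top.
      by rewrite -uE; exact: (hsl_homE fn ((u : hsl_hom _ _) t)).
    apply/eqP; rewrite eq_le lex1 /= -[X in X <= _]ft.
    by move/le_meetP: xa => <-; rewrite hsl_meet leIr.
  by have [v [vE _]] := f_univ _ _ f0; exists v.
Defined.

(* The category ELHSLat; the display d only affects notation.                 *)
Definition ELHSLat (d : Order.disp_t) : pointed_category :=
  @PointedCategory (elhslat_cat d) (elhs_zero d) (@elhs_prod d) (@elhs_coprod d)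
    (@elhs_pull d) (@elhs_image d) (@elhs_ncl d).

(* Main.v *)
Require Import Defs.
From mathcomp Require Import ssreflect ssrfun ssrbool eqtype.
From mathcomp Require Import order.

(** Call [a] and [b] codisjoint when their only common upper bound is the top
    element.  Everything reduces to one description: two morphisms into [A]
    Huq-commute if and only if every value of the first is codisjoint from every
    value of the second.

    If [phi] witnesses that [x] and [y] commute, then [(s,1) -> (1,t) = (1,t)]
    in the product forces [x s -> y t = y t], and symmetrically; by the linearity
    axiom [z = ((a -> b) -> z) /\ ((b -> a) -> z)], the equations [a -> b = b]
    and [b -> a = a] make every common upper bound [z] of [a] and [b] equal to
    the top ([codisjointP]).  Conversely these equations are exactly what makes
    [(s,t) |-> x s /\ y t] preserve the implication ([huq_codisjoint]).  The
    Higgins commutator gives the same condition, because the kernel of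
    [X + Y -> X * Y] contains [(s -> t) -> t] and [(t -> s) -> s]
    ([higgins_codisjoint]).

    Codisjointness is inherited by larger elements, and a normal closure is the
    filter generated by the subobject, so commutation passes to normal closures.

    For (SH), let [R] and [S] have codisjoint zero-classes.  An element of both
    classes is codisjoint from itself, hence the top, so an element is determined
    by its classes modulo [R] and modulo [S] ([normalisations_separate]).  The
    Mal'tsev term [p] of Heyting semilattices satisfies [p a b c == c] modulo [R]
    and [p a b c == a] modulo [S] whenever [a R b S c]; as these two congruences
    characterise [p a b c], it depends homomorphically on the triple, and it is
    the connector required by Smith commutation.  Conversely, a connector sends
    the triples [(a,1,1)] and [(1,1,b)], each fixed by the implication from the
    other one, to [a] and [b], which are therefore codisjoint
    ([smith_codisjoint]). *)

Set Implicit Arguments.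
Unset Strict Implicit.
Unset Printing Implicit Defensive.

Import Order.Theory.
Local Open Scope order_scope.
Local Open Scope cat_scope.

(** * Heyting semilattices *)

Section HeytingSemilattice.
Variables (d : Order.disp_t) (A : heytingSemilatticeType d).
Implicit Types a b c u z : A.

Lemma eq_lower a b : (forall u, (u <= a) = (u <= b)) -> a = b.
Proof. by move=> e; apply/eqP; rewrite eq_le -e lexx e lexx. Qed.

Lemma himp_eq_top a b : (a `->` b = \top) <-> (a <= b).
Proof.
rewrite -[a in a <= b]meet1x leIx_himp; split=> [->|ab]; first exact: lexx.
by apply/eqP; rewrite eq_le lex1.
Qed.

Lemma himpxx a : a `->` a = \top.
Proof. exact/himp_eq_top. Qed.

Lemma himpx1 a : a `->` \top = \top.
Proof. by apply/himp_eq_top; exact: lex1. Qed.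

Lemma himp1x a : \top `->` a = a.
Proof. by apply: eq_lower => u; rewrite -leIx_himp meetx1. Qed.

Lemma himp_curry a b c : (a `&` b) `->` c = a `->` (b `->` c).
Proof. by apply: eq_lower => u; rewrite -!leIx_himp meetA. Qed.

Lemma himpI a b c : a `->` (b `&` c) = (a `->` b) `&` (a `->` c).
Proof. by apply: eq_lower => u; rewrite lexI -!leIx_himp lexI. Qed.

Lemma le_himpr a b : b <= a `->` b.
Proof. by rewrite -leIx_himp leIl. Qed.

Lemma le_himp_himp a b : a <= (a `->` b) `->` b.
Proof. by rewrite -leIx_himp meetC leIx_himp. Qed.

Lemma himp_himp_eq_top a b : ((a `->` b) `->` b = \top) <-> (a `->` b = b).
Proof.
split=> [/himp_eq_top ab|->]; last exact: himpxx.
by apply/eqP; rewrite eq_le ab le_himpr.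
Qed.

Definition codisjoint a b : Prop := forall z, a <= z -> b <= z -> z = \top.

Lemma codisjoint_sym a b : codisjoint a b -> codisjoint b a.
Proof. by move=> ab z bz az; exact: ab. Qed.

Lemma codisjoint_le a a' b b' :
  a <= a' -> b <= b' -> codisjoint a b -> codisjoint a' b'.
Proof.
by move=> aa bb ab z az bz; apply: ab; [apply: le_trans az|apply: le_trans bz].
Qed.

Lemma codisjoint_himp a b : codisjoint a b -> a `->` b = b.
Proof.
by move=> ab; apply/himp_himp_eq_top/ab; [exact: le_himp_himp|exact: le_himpr].
Qed.

(** Heyting semilattices form a Mal'tsev variety; this is the Mal'tsev term. *)
Definition maltsev a b c : A := ((a `->` b) `->` c) `&` ((c `->` b) `->` a).

Lemma maltsev_left a c : maltsev a a c = c.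
Proof. by rewrite /maltsev himpxx himp1x; apply/meet_idPl; exact: le_himp_himp. Qed.

Lemma maltsev_right a c : maltsev a c c = a.
Proof. by rewrite /maltsev himpxx himp1x; apply/meet_idPr; exact: le_himp_himp. Qed.

End HeytingSemilattice.

(** This is where linearity enters: in a general Heyting semilattice the two
    equations do not prevent [a] and [b] from having a common upper bound other
    than the top. *)
Lemma codisjointP d (A : elhslatType d) (a b : A) :
  codisjoint a b <-> (a `->` b = b /\ b `->` a = a).
Proof.
split=> [ab|[ab ba] z /himp_eq_top az /himp_eq_top bz].
  by split; apply: codisjoint_himp => //; exact: codisjoint_sym.
by rewrite -(himp_linear a b z) ab ba az bz meetxx.
Qed.

(** Recognising codisjoint elements as images, under one morphism, of elements
    that already satisfy the two equations; the product in Huq commutation and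
    the object of triples in Smith commutation both provide such elements. *)
Lemma codisjoint_image d (T A : elhslatType d) (f : hsl_hom T A) (p q : T) :
  p `->` q = q -> q `->` p = p -> codisjoint (f p) (f q).
Proof. by move=> pq qp; apply/codisjointP; rewrite -!hsl_himp pq qp. Qed.

(** * Kernels and images in a pointed category *)

Section PointedCategory.
Variable C : pointed_category.
Implicit Types A B X Y Z : C.

Lemma zero_mor_comp A B Z (f : Hom Z A) : zerom A B ∘ f = zerom Z B.
Proof. by rewrite /zerom /zero_mor -Defs.compA; congr (_ ∘ _); exact: zto_uniq. Qed.

Lemma zero_subobjectE X A (x : Hom X A) : zero_subobject x <-> x = zerom X A.
Proof.
split=> [[u <-]|->]; last by exists (zto zeroC X).
by congr (_ ∘ _); exact: zto_uniq.
Qed.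

Lemma kernel_normal A B (f : Hom A B) : normal_mono zeroC (kernel f).
Proof.
exists B, f; split=> [|Z h fh].
  by rewrite /kernel pb_comm; congr (_ ∘ _); exact: zto_uniq.
exists (pb_lift (kernel_pb f) fh); split=> [|u uE]; first exact: pb1_lift.
apply: (pb_uniq (p := kernel_pb f)); last exact: zto_uniq.
by rewrite pb1_lift -uE.
Qed.

Lemma regular_epi_cancel A B D (e : Hom A B) (g h : Hom B D) :
  regular_epi e -> g ∘ e = h ∘ e -> g = h.
Proof.
case=> Z [u [v [euv univ]]] gh.
have [|k [_ uniq_k]] := univ D (g ∘ e); first by rewrite -!Defs.compA euv.
by rewrite -(uniq_k g) // -(uniq_k h).
Qed.

(** The morphism factors through its image by a regular epimorphism, which can be
    cancelled. *)
Lemma zero_subobject_higginsE A X Y (x : Hom X A) (y : Hom Y A) :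
  zero_subobject (higgins x y) <->
  copairm (coprodC X Y) x y ∘ cosmash_incl X Y = zerom _ _.
Proof.
rewrite zero_subobjectE -(im_fact (higgins_image x y)); split=> [e|e].
  by rewrite [im_mono _]e zero_mor_comp.
by apply: regular_epi_cancel (im_epiP _) _; rewrite [LHS]e zero_mor_comp.
Qed.

End PointedCategory.

(** * Huq commutation and the Higgins commutator *)

Section Commutation.
Variable d : Order.disp_t.
Variables X Y A : elhslatType d.
Variables (x : hsl_hom X A) (y : hsl_hom Y A).

Let prod_himp_lr (s : X) (t : Y) :
  ((s, \top) : prod_alg X Y) `->` (\top, t) = (\top, t).
Proof. by congr pair; [exact: himpx1|exact: himp1x]. Qed.

Let prod_himp_rl (s : X) (t : Y) :
  ((\top, t) : prod_alg X Y) `->` (s, \top) = (s, \top).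
Proof. by congr pair; [exact: himp1x|exact: himpx1]. Qed.

Section Cooperator.
Hypothesis xy : forall s t, codisjoint (x s) (y t).

(** Since [y t -> x s' = x s'] and [x s -> y t' = y t'], the implication from
    [x s /\ y t] to [x s' /\ y t'] is [(x s -> x s') /\ (y t -> y t')], so it is
    computed in each factor separately. *)
Definition cooperator : hsl_hom (prod_alg X Y) A.
Proof.
exists (fun st => x st.1 `&` y st.2).
- by rewrite !hsl_top meetxx.
- by move=> [s t] [s' t']; rewrite /= !hsl_meet meetACA.
- move=> [s t] [s' t']; rewrite /= himpI !hsl_himp; congr (_ `&` _).
    rewrite [x s `&` _]meetC himp_curry -hsl_himp.
    by rewrite (codisjoint_himp (codisjoint_sym (@xy _ _))).
  by rewrite himp_curry -hsl_himp (codisjoint_himp (@xy _ _)).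
Defined.

End Cooperator.

Lemma huq_codisjoint :
  @huq_commute (ELHSLat d) A X Y x y <-> forall s t, codisjoint (x s) (y t).
Proof.
split=> [[phi [phix phiy]] s t|xy].
  rewrite -(hsl_homE phix s) -(hsl_homE phiy t).
  exact: (codisjoint_image (f := phi) (prod_himp_lr s t) (prod_himp_rl s t)).
exists (cooperator xy); split; apply: (@hsl_homP _ _ A) => s /=.
  by rewrite hsl_top meetx1.
by rewrite hsl_top meet1x.
Qed.

Let zero_on_cosmash :
  (copairm (@coprodC (ELHSLat d) X Y) x y ∘ @cosmash_incl (ELHSLat d) X Y =
     @zerom (ELHSLat d) _ _) <->
  forall w : coprod_elhs X Y,
    (@coprod_to_prod (ELHSLat d) X Y : hsl_hom _ _) w = \top ->
    coprod_case x y w = \top.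
Proof.
split=> [xy w wE|xy].
  have wP : pull_subalg (@coprod_to_prod (ELHSLat d) X Y)
      (zfrom (elhs_zero d) (prod_alg X Y)) (w, tt) by apply/eqP.
  exact: (hsl_homE xy (exist _ (w, tt) wP)).
by apply: (@hsl_homP _ _ A) => -[[w []] /= /eqP wE]; exact: xy.
Qed.

(** The elements [(s -> t) -> t] and [(t -> s) -> s] of the coproduct lie in the
    cosmash product, and their vanishing in [A] is already codisjointness. *)
Lemma higgins_codisjoint :
  @zero_subobject (ELHSLat d) _ A (@higgins (ELHSLat d) A X Y x y) <->
  forall s t, codisjoint (x s) (y t).
Proof.
rewrite zero_subobject_higginsE zero_on_cosmash.
split=> [xy s t|/huq_codisjoint[phi [phix phiy]] w wE].
  pose i := coprod_inl X Y s; pose j := coprod_inr X Y t.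
  have inl_case (Z : elhslatType d) (f : hsl_hom X Z) (g : hsl_hom Y Z) :
      coprod_case f g i = f s.
    exact: coprod_caseE.
  have inr_case (Z : elhslatType d) (f : hsl_hom X Z) (g : hsl_hom Y Z) :
      coprod_case f g j = g t.
    exact: coprod_caseE.
  apply/codisjointP; split; apply/himp_himp_eq_top.
    rewrite -(inl_case _ x y) -(inr_case _ x y) -!hsl_himp; apply: xy.
    rewrite !hsl_himp inl_case inr_case.
    by apply/himp_himp_eq_top; exact: prod_himp_lr.
  rewrite -(inl_case _ x y) -(inr_case _ x y) -!hsl_himp; apply: xy.
  rewrite !hsl_himp inl_case inr_case.
  by apply/himp_himp_eq_top; exact: prod_himp_rl.
have phiE : phi ∘ @coprod_to_prod (ELHSLat d) X Y =
    copairm (@coprodC (ELHSLat d) X Y) x y.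
  by apply: copairm_uniq; rewrite -Defs.compA ?copairm_inl ?copairm_inr.
have <- := hsl_homE phiE w.
by rewrite -[LHS]/((phi : hsl_hom _ _) _) -(hsl_top phi) -wE.
Qed.

End Commutation.

(** * Smith is Huq *)

Section Smith.
Variable d : Order.disp_t.
Variable A : elhslatType d.

Section Relation.
Variable R : @equivalence_relation (ELHSLat d) A.

Let src : hsl_hom (er_ob R : elhslatType d) A := er1 R.
Let tgt : hsl_hom (er_ob R : elhslatType d) A := er2 R.

Definition related (a b : A) : Prop := exists r, src r = a /\ tgt r = b.

Lemma related_er r : related ((er1 R : hsl_hom _ _) r) ((er2 R : hsl_hom _ _) r).
Proof. by exists r. Qed.

Lemma related_refl a : related a a.
Proof.
by exists ((er_refl R : hsl_hom _ _) a); split;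
  [exact: (hsl_homE (er1_refl R) a)|exact: (hsl_homE (er2_refl R) a)].
Qed.

Lemma related_sym a b : related a b -> related b a.
Proof.
case=> r [<- <-]; have [s [s1 s2]] := er_sym R.
by exists ((s : hsl_hom _ _) r); split; [exact: (hsl_homE s1 r)|exact: (hsl_homE s2 r)].
Qed.

Lemma related_meet a a' b b' :
  related a a' -> related b b' -> related (a `&` b) (a' `&` b').
Proof. by case=> r [<- <-] [s [<- <-]]; exists (r `&` s); rewrite !hsl_meet. Qed.

Lemma related_himp a a' b b' :
  related a a' -> related b b' -> related (a `->` b) (a' `->` b').
Proof. by case=> r [<- <-] [s [<- <-]]; exists (r `->` s); rewrite !hsl_himp. Qed.

Lemma related_maltsev a a' b b' c c' : related a a' -> related b b' ->
  related c c' -> related (maltsev a b c) (maltsev a' b' c').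
Proof. by move=> aa bb cc; apply: related_meet; do 2!apply: related_himp => //. Qed.

Lemma normalisationP a :
  (exists k, (normalisation R : hsl_hom _ _) k = a) <-> related \top a.
Proof.
split=> [[[[r []] /= /eqP r1] ra]|[r [r1 ra]]]; first by exists r.
have rP : pull_subalg (er1 R) (zfrom (elhs_zero d) A) (r, tt) by apply/eqP.
by exists (exist _ (r, tt) rP).
Qed.

End Relation.

Variables R S : @equivalence_relation (ELHSLat d) A.

Definition codisjoint_classes : Prop :=
  forall a b, related R \top a -> related S \top b -> codisjoint a b.

Lemma huq_normalisations :
  huq_commute (normalisation R) (normalisation S) <-> codisjoint_classes.
Proof.
rewrite huq_codisjoint; split=> [RS a b|RS k l].
  by move=> /normalisationP[k <-] /normalisationP[l <-]; exact: RS.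
by apply: RS; apply/normalisationP; [exists k|exists l].
Qed.

(** The implication between two elements with the same classes is in both
    zero-classes, so it is codisjoint from itself. *)
Lemma normalisations_separate u v c a : codisjoint_classes ->
  related R u c -> related R v c -> related S u a -> related S v a -> u = v.
Proof.
move=> RS.
have le_same u' v' : related R u' c -> related R v' c ->
    related S u' a -> related S v' a -> u' <= v'.
  move=> uc vc ua va; apply/himp_eq_top.
  have Ruv : related R \top (u' `->` v').
    by apply: related_sym; rewrite -(himpxx c); exact: related_himp.
  have Suv : related S \top (u' `->` v').
    by apply: related_sym; rewrite -(himpxx a); exact: related_himp.
  exact: (RS _ _ Ruv Suv).
by move=> uc vc ua va; apply/eqP; rewrite eq_le !le_same.
Qed.

Section Connector.
Hypothesis RS : codisjoint_classes.

Let triple : elhslatType d := pb_ob (smith_pb R S).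
Let r_a : hsl_hom triple A := er1 R ∘ pb1 (smith_pb R S).
Let r_b : hsl_hom triple A := er2 R ∘ pb1 (smith_pb R S).
Let r_c : hsl_hom triple A := er2 S ∘ pb2 (smith_pb R S).

Let theta (t : triple) : A := maltsev (r_a t) (r_b t) (r_c t).

Let theta_R t : related R (theta t) (r_c t).
Proof.
rewrite -[X in related R _ X](maltsev_left (r_b t)).
by apply: related_maltsev; [exact: related_er|exact: related_refl..].
Qed.

Let theta_S t : related S (theta t) (r_a t).
Proof.
rewrite -[X in related S _ X](maltsev_right _ (r_c t)).
apply: related_maltsev; [exact: related_refl| |exact: related_refl].
have bc := hsl_homE (pb_comm (smith_pb R S)) t.
by rewrite [r_b t]bc; exact: related_er.
Qed.

Let theta_uniq t v : related R v (r_c t) -> related S v (r_a t) -> theta t = v.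
Proof. by move=> vR vS; apply: normalisations_separate (theta_S t) vS. Qed.

Definition connector : hsl_hom triple A.
Proof.
exists theta => [|t t'|t t'].
- by apply: theta_uniq; rewrite hsl_top; exact: related_refl.
- by apply: theta_uniq; rewrite hsl_meet; apply: related_meet.
- by apply: theta_uniq; rewrite hsl_himp; apply: related_himp.
Defined.

Lemma connectorE t : connector t = maltsev (r_a t) (r_b t) (r_c t).
Proof. by []. Qed.

End Connector.

Lemma smith_codisjoint : smith_commute R S <-> codisjoint_classes.
Proof.
split=> [[theta [theta_r theta_l]] a b aR bS|RS].
  have [r [ra rb]] := related_sym aR; have [s [sa sb]] := bS.
  rewrite -ra -sb -(hsl_homE theta_l r) -(hsl_homE theta_r s).
  (* The arguments are now the values of theta at (a, 1, 1) and (1, 1, b). *)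
  apply: (codisjoint_image (f := theta)); apply: val_inj => /=; congr pair => /=.
  - by rewrite sa hsl_top; exact: himpx1.
  - by rewrite rb hsl_top; exact: himp1x.
  - by rewrite sa hsl_top; exact: himp1x.
  - by rewrite rb hsl_top; exact: himpx1.
exists (connector RS); split; apply: (@hsl_homP _ _ A) => t.
  set a := (er1 S : hsl_hom _ _) t; rewrite -[LHS]/(connector RS _) connectorE /=.
  rewrite [X in maltsev X](hsl_homE (er1_refl R) a).
  by rewrite [X in maltsev _ X](hsl_homE (er2_refl R) a) maltsev_left.
set c := (er2 R : hsl_hom _ _) t; rewrite -[LHS]/(connector RS _) connectorE /=.
by rewrite [X in maltsev _ _ X](hsl_homE (er2_refl S) c) maltsev_right.
Qed.

End Smith.

(** * Normal closures *)

(** The elements above some value of [x] form the kernel of [ncl_quot x]; this is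
    a normal subobject containing [x], so it contains the normal closure. *)
Lemma nclosure_above d (X A : elhslatType d) (x : hsl_hom X A) n :
  exists t, x t <= (@nclosure (ELHSLat d) X A x : hsl_hom _ _) n.
Proof.
pose q : @Hom (ELHSLat d) A (quot_alg d (ncl_raw x)) := ncl_quot x.
have xq : q ∘ (x : @Hom (ELHSLat d) X A) = zfrom (elhs_zero d) _ ∘ zto (elhs_zero d) X.
  by apply: (@hsl_homP _ _ (quot_alg d (ncl_raw x))) => t; apply/ncl_quotE; exists t.
have [|u uE] := ncl_smallest (@nclC (ELHSLat d) X A x)
  (@kernel_normal (ELHSLat d) _ _ q).
  by exists (pb_lift (@kernel_pb (ELHSLat d) _ _ q) xq); exact: pb1_lift.
apply/ncl_quotE; rewrite /nclosure -uE.
exact: (hsl_homE (pb_comm (@kernel_pb (ELHSLat d) _ _ q)) ((u : hsl_hom _ _) n)).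
Qed.

(** * Condition (W) *)

Theorem corollary3p9 (d : Order.disp_t) : condition_W (ELHSLat d).
Proof.
split=> [A R S|A X Y x y _ _].
  by rewrite smith_codisjoint huq_normalisations.
rewrite !higgins_codisjoint; split=> [xy a b|xy s t].
  have [[s sa] [t tb]] := (nclosure_above a, nclosure_above b).
  exact: codisjoint_le sa tb (xy s t).
have [[u ux] [v vy]] := (ncl_contains (nclC x), ncl_contains (nclC y)).
by rewrite -(hsl_homE ux s) -(hsl_homE vy t); exact: xy.
Qed.
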